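(* Let $(X,f)$ be a dynamical system such that $X$ has at least two elements and the minimal points of $f$ are dense in $X$. If $(X,f)$ has the $\underline{d}$-shadowing property or the $\overline{d}$-shadowing property, then for every $n\in\mathbb{N}$ the dynamical system $(X,f^n)$ is syndetically sensitive.
   Context: $\mathbb{N}=\{1,2,\dots\}$, $\mathbb{N}_0=\mathbb{N}\cup\{0\}$. A dynamical system $(X,f)$ is a compact metric space $(X,d)$ together with a continuous map $f\colon X\to X$. A minimal set is a nonempty closed invariant set with no nonempty closed invariant proper subset; a minimal point is an element of a minimal set. A set $S\subset\mathbb{N}_0$ is syndetic if there is $k>0$ with $S\cap[i,i+k]\ne\emptyset$ for all $i\in\mathbb{N}_0$. A map $h\colon X\to X$ is syndetically sensitive if there is $\delta>0$ such that for every nonempty open $U\subset X$ the set $\{m\in\mathbb{N}_0:\text{there exist }y,z\in U\text{ with }d(h^m(y),h^m(z))>\delta\}$ is syndetic. For $A\subset\mathbb{N}_0$, $\overline{d}(A)=\limsup_{n\to\infty}\frac1n|A\cap\{0,\dots,n-1\}|$ and $\underline{d}(A)=\liminf_{n\to\infty}\frac1n|A\cap\{0,\dots,n-1\}|$. A sequence $\{x_i\}_{i=0}^\infty\subset X$ is a $\delta$-ergodic pseudo-orbit of $f$ if $\lim_{n\to\infty}\frac1n|\{0\le i<n: d(f(x_i),x_{i+1})\ge\delta\}|=0$. $(X,f)$ has the $\underline{d}$-shadowing property (resp. the $\overline{d}$-shadowing property) if for every $\varepsilon>0$ there is $\delta>0$ such that for every $\delta$-ergodic pseudo-orbit $\{x_i\}_{i=0}^\infty$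 there is $z\in X$ with $\underline{d}(\{i\in\mathbb{N}_0: d(f^i(z),x_i)<\varepsilon\})>0$ (resp. $\overline{d}(\{i\in\mathbb{N}_0: d(f^i(z),x_i)<\varepsilon\})>1/2$). *)

(* Defs.v *)
From HB Require Import structures.
From mathcomp Require Import all_boot all_order all_algebra.
From mathcomp Require Import boolp classical_sets reals constructive_ereal.
From mathcomp Require Import topology normedtype sequences.

Set Implicit Arguments.
Unset Strict Implicit.
Unset Printing Implicit Defensive.

Import Order.TTheory GRing.Theory Num.Theory.
Import numFieldNormedType.Exports.

Local Open Scope classical_set_scope.
Local Open Scope ring_scope.

Section Density.
Variable R : realType.

(* At n = 0 the value is 0 / 0 = 0, which is irrelevant for the limits. *)
Definition frequency (A : set nat) (n : nat) : R :=
  #|[pred i : 'I_n | `[< A i >]]|%:R / n%:R.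

Definition upper_density (A : set nat) : \bar R :=
  limn_esup (fun n => (frequency A n)%:E).

Definition lower_density (A : set nat) : \bar R :=
  limn_einf (fun n => (frequency A n)%:E).

End Density.

Definition syndetic (S : set nat) : Prop :=
  exists2 k : nat, (0 < k)%N &
    forall i : nat, S `&` [set j | (i <= j <= i + k)%N] !=set0.

Section Minimality.
Variable X : topologicalType.

Definition nonempty_closed_invariant (f : X -> X) (A : set X) : Prop :=
  [/\ A !=set0, closed A & f @` A `<=` A].

Definition minimal_set (f : X -> X) (M : set X) : Prop :=
  nonempty_closed_invariant f M /\
  forall A : set X, nonempty_closed_invariant f A -> ~ (A `<` M).

Definition minimal_point (f : X -> X) (x : X) : Prop :=
  exists2 M : set X, minimal_set f M & M x.

End Minimality.

Section MetricDynamics.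
Variables (R : realType) (X : metricType R).

Definition sensitivity_times (h : X -> X) (delta : R) (U : set X) : set nat :=
  [set m | exists y z, [/\ U y, U z & delta < mdist (iter m h y) (iter m h z)]].

Definition syndetically_sensitive (h : X -> X) : Prop :=
  exists2 delta : R, 0 < delta &
    forall U : set X, open U -> U !=set0 -> syndetic (sensitivity_times h delta U).

Definition ergodic_pseudo_orbit (f : X -> X) (delta : R) (x : nat -> X) : Prop :=
  frequency R [set i | delta <= mdist (f (x i)) (x i.+1)] n @[n --> \oo] --> (0 : R).

Definition tracing_times (f : X -> X) (eps : R) (x : nat -> X) (z : X) : set nat :=
  [set i | mdist (iter i f z) (x i) < eps].

Definition lower_density_shadowing (f : X -> X) : Prop :=
  forall eps : R, 0 < eps -> exists2 delta : R, 0 < delta &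
    forall x : nat -> X, ergodic_pseudo_orbit f delta x ->
      exists z : X, (0 < lower_density R (tracing_times f eps x z))%E.

Definition upper_density_shadowing (f : X -> X) : Prop :=
  forall eps : R, 0 < eps -> exists2 delta : R, 0 < delta &
    forall x : nat -> X, ergodic_pseudo_orbit f delta x ->
      exists z : X, ((2^-1)%:E < upper_density R (tracing_times f eps x z))%E.

End MetricDynamics.

(* Main.v *)
Require Import Defs.
From HB Require Import structures.
From Stdlib Require Import PeanoNat.
From mathcomp Require Import all_boot all_order all_algebra.
From mathcomp Require Import boolp classical_sets reals constructive_ereal.
From mathcomp Require Import topology normedtype sequences.
From mathcomp Require Import ereal zify lra.

Set Implicit Arguments.
Unset Strict Implicit.
Unset Printing Implicit Defensive.

Import Order.TTheory GRing.Theory Num.Theory.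
Import numFieldNormedType.Exports.
Local Open Scope classical_set_scope.
Local Open Scope ring_scope.

(** Why the theorem is true.

    Follow the orbit of [x] for a while, then jump to the orbit of [y] (at the
    same absolute time), then back, and so on.  If the blocks between jumps
    grow, the jumps have density zero, so this is an ergodic pseudo-orbit for
    every [delta].  The lengths of the blocks are chosen so that no set living
    eventually on the [x]-blocks alone, or on the [y]-blocks alone, is dense
    enough to be a set of tracing times: super-exponential blocks make each
    family of lower density zero, and blocks [[k^2, (k+1)^2)] make each family
    of density one half.  So under either form of shadowing some [z] is close
    to [f^i x] for arbitrarily late [i] and to [f^i y] for arbitrarily late [i]
    ([trace_two_orbits]).  A point of a minimal set returns to an open set
    within bounded time, and over a bounded time closeness persists, so when
    [x] and [y] are minimal both [z] and [x] can be made to visit an open [U]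
    at one time, and both [z] and [y] an open [V] at a later time
    ([parallel_visits]).  With minimal points dense this yields transitivity,
    and, by taking [y = f x] and [V = U], two consecutive integers [m], [m + 1]
    such that [U] meets both [f^-m U] and [f^-(m+1) U]
    ([consecutive_returns]).

    Suppose now that [U] stays [delta]-small under [f^i, ..., f^(i+k)], where
    [k] is as large as desired.  Given any [v], transitivity and density give a
    minimal [w] in [U] whose orbit passes near [v], hence passes near [v] within
    every window of a fixed length, so at some time [j + m] with [j], [j + m]
    and [j + m + 1] inside the interval.  All points of [U] are interchangeable
    at these times up to [delta]; sliding [w] along the points that realize the
    returns of [U] after [m] and [m + 1] steps shows that [f^(j+m) w] and
    [f^(j+m+1) w] are [3 delta]-close, so [v] and [f v] are [5 delta]-close
    ([insensitive_displacement]).  If [f] were not syndetically sensitive this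
    would hold for every [delta], so [f] would be the identity, which is not
    transitive on a space with two points.  Finally, syndetic sensitivity
    passes from [f] to its iterates by uniform continuity
    ([syndetically_sensitive_iter]). *)

(** * Counting and densities *)

Definition hits (A : set nat) (n : nat) : nat := #|[pred i : 'I_n | `[< A i >]]|.

Lemma frequencyE (R : realType) A n : frequency R A n = (hits A n)%:R / n%:R.
Proof. by []. Qed.

Lemma hits0 A : hits A 0 = 0%N.
Proof. by apply: eq_card0 => -[]. Qed.

Lemma hitsS A n : hits A n.+1 = (hits A n + `[< A n >])%N.
Proof.
have hitsE m : hits A m = (\sum_(i < m) `[< A i >])%N.
  by rewrite /hits -sum1_card big_mkcond; apply: eq_bigr => i _; rewrite inE; case: ifP.
by rewrite !hitsE big_ord_recr.
Qed.

Lemma hits_le_cofinite (A B : set nat) (N n : nat) :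
  (forall i, (N <= i)%N -> A i -> B i) -> (hits A n <= N + hits B n)%N.
Proof.
move=> AB; elim: n => [|n IH]; first by rewrite !hits0.
suff : (hits A n.+1 <= n.+1)%N /\ (hits A n.+1 <= N + hits B n.+1)%N by case.
split; first by rewrite /hits -[leqRHS]card_ord max_card.
have hn : (hits A n <= n)%N by rewrite /hits -[leqRHS]card_ord max_card.
rewrite !hitsS; have [Nn|nN] := leqP N n.
  have : (`[< A n >] <= `[< B n >])%N.
    by case: asboolP => // An; rewrite (asboolT (AB _ Nn An)).
  by lia.
by case: (`[< A n >]); case: (`[< B n >]); lia.
Qed.

Lemma hits_switches (kappa : nat -> nat) (n : nat) :
  {homo kappa : i j / (i <= j)%N} ->
  (hits [set i | kappa i.+1 <> kappa i] n <= kappa n)%N.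
Proof.
move=> mono; elim: n => [|n IH]; first by rewrite hits0.
rewrite hitsS; have := mono _ _ (leqnSn n).
by case: asboolP => /= kn; lia.
Qed.

Lemma lower_density_le0 (R : realType) (A : set nat) :
  (forall e : R, 0 < e -> forall N : nat,
     exists2 n, (N <= n)%N & frequency R A n <= e) ->
  (lower_density R A <= 0)%E.
Proof.
move=> small; rewrite /lower_density limn_einf_lim.
have -> : limn (einfs (fun n => (frequency R A n)%:E)) = ereal_sup (range (einfs (fun n => (frequency R A n)%:E))).
  by apply/cvg_lim; [exact: ereal_hausdorff|exact: cvg_einfs_sup].
apply: ge_ereal_sup => _ [N _ <-]; apply/lee_addgt0Pr => e e0.
have [n Nn fe] := small e e0 N.
by rewrite add0e; apply: ge_ereal_inf; exists (frequency R A n)%:E; [exists n|].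
Qed.

Lemma upper_density_le (R : realType) (A : set nat) (a : R) :
  (forall e : R, 0 < e -> \forall n \near \oo, frequency R A n <= a + e) ->
  (upper_density R A <= a%:E)%E.
Proof.
move=> small; rewrite /upper_density limn_esup_lim.
have -> : limn (esups (fun n => (frequency R A n)%:E)) = ereal_inf (range (esups (fun n => (frequency R A n)%:E))).
  by apply/cvg_lim; [exact: ereal_hausdorff|exact: cvg_esups_inf].
apply/lee_addgt0Pr => e e0; have [N _ fe] := small e e0.
apply: ge_ereal_inf; exists (esups (fun n => (frequency R A n)%:E) N); first by exists N.
by apply: ge_ereal_sup => _ [n Nn <-]; rewrite -EFinD lee_fin fe.
Qed.

(** * Pseudo-orbits that switch between two orbits *)

(** The value [kappa i] is the index of the block containing [i]. *)
Definition switch_orbit (X : Type) (kappa : nat -> nat) (f : X -> X) (x y : X) (i : nat) : X :=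
  iter i f (if odd (kappa i) then x else y).

(** A nonzero error at time [i] forces a change of block, and there are at most
    [kappa n], hence at most [sqrt n], of these before time [n]. *)
Lemma switch_orbit_ergodic (R : realType) (X : metricType R)
    (kappa : nat -> nat) (f : X -> X) (x y : X) (delta : R) :
  {homo kappa : i j / (i <= j)%N} -> (forall n, (kappa n ^ 2 <= n)%N) ->
  0 < delta -> ergodic_pseudo_orbit f delta (switch_orbit kappa f x y).
Proof.
move=> mono slow delta0; apply/cvgrPdist_le => e e0.
near=> n.
have n0 : (0 < n)%N by near: n; exact: nbhs_infty_gt.
have nR : (0 : R) < n%:R by rewrite ltr0n.
have en : (e ^+ 2)^-1 <= n%:R by near: n; exact: nbhs_infty_ger.
have hk : (hits [set i | (delta <= mdist (f (switch_orbit kappa f x y i))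
    (switch_orbit kappa f x y i.+1))%R] n <= kappa n)%N.
  apply: leq_trans (hits_switches n mono).
  apply: (@hits_le_cofinite _ _ 0) => i _ /= far same; move: far.
  by rewrite /switch_orbit same -iterS mdistxx leNgt delta0.
rewrite sub0r normrN frequencyE ger0_norm ?divr_ge0//.
rewrite ler_pdivrMr//.
apply: (@le_trans _ _ (kappa n)%:R); first by rewrite ler_nat.
have en0 : 0 <= e * n%:R by rewrite mulr_ge0// ltW.
rewrite -(@ler_pXn2r _ 2) ?nnegrE//.
apply: (@le_trans _ _ n%:R); first by rewrite -natrX ler_nat.
rewrite exprMn [n%:R ^+ 2]expr2 mulrA ler_peMl//.
by rewrite -ler_pdivrMl ?mulr1 ?exprn_gt0.
Unshelve. all: by end_near. Qed.

(** ** Blocks [[2^2^k, 2^2^(k+1))] of one parity have lower density zero *)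

Lemma double_log_slow n : (trunc_log 2 (trunc_log 2 n) ^ 2 <= n)%N.
Proof.
set k := trunc_log 2 (trunc_log 2 n).
have dbl j : (2 * j <= 2 ^ j)%N.
  by elim: j => [|[|j] IH]//; rewrite expnS; lia.
have [->//|k0] := posnP k.
have l0 : (0 < trunc_log 2 n)%N by move: k0; rewrite /k; case: (trunc_log 2 n).
have n0 : (0 < n)%N by move: l0; case: n {k k0}.
apply: leq_trans (trunc_logP (ltnSn 1) n0).
have := trunc_logP (ltnSn 1) l0; rewrite -/k => kl.
apply: (@leq_trans (2 ^ (2 * k))).
  by rewrite mulnC expnM leq_exp2r// ltnW// ltn_expl.
by rewrite leq_exp2l// (leq_trans (dbl k)).
Qed.

(** Each block is squared in length by the next one: with [n = 2^2^k] and [k] of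
    the parity avoided by [A], the set [A] misses [[n, n^2)], so its frequency
    at [n^2] is at most [n / n^2]. *)
Lemma double_log_blocks (R : realType) (A : set nat) (N : nat) (b : bool) :
  (forall i, (N <= i)%N -> A i -> odd (trunc_log 2 (trunc_log 2 i)) = b) ->
  (lower_density R A <= 0)%E.
Proof.
move=> Ab; apply: lower_density_le0 => e e0 M.
pose m := Num.truncn (e^-1).
(* The parity of k is opposite to b, and k is so large that 1 / n <= e. *)
pose k := (2 * (N + M + m) + ~~ b + 2)%N.
have kk : (k < 2 ^ 2 ^ k)%N by rewrite (ltn_trans (ltn_expl k (ltnSn 1)))// ltn_expl.
set n := (2 ^ 2 ^ k)%N in kk *.
have n0 : (0 < n)%N by lia.
exists (n ^ 2)%N; first by rewrite /k in kk; nia.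
have nn : (hits A (n ^ 2) <= n)%N.
  have stop j : (n <= j <= n ^ 2)%N -> (hits A j <= n)%N.
    elim: j => [|j IH]; first by lia.
    rewrite leq_eqVlt => /andP[/orP[/eqP nj|nj] jn].
      by rewrite nj /hits -[leqRHS]card_ord max_card.
    rewrite hitsS; case: asboolP => [Aj|_]; last by rewrite addn0 IH//; lia.
    have := Ab j _ Aj; rewrite (_ : trunc_log 2 (trunc_log 2 j) = k).
      have -> : odd k = ~~ b by rewrite /k; case: (b); lia.
      by case: (b) => H; have := H ltac:(rewrite /k in kk; lia).
    apply: trunc_log_eq => //; apply/andP; split.
      by apply: trunc_log_max => //; rewrite -/n; lia.
    rewrite -(@ltn_exp2l 2)//; apply: leq_ltn_trans (trunc_logP _ _) _ => //; first by lia.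
    by rewrite expnSr expnM -/n; lia.
  by apply: stop; nia.
rewrite frequencyE ler_pdivrMr ?ltr0n ?expn_gt0 ?n0//.
apply: (@le_trans _ _ n%:R); first by rewrite ler_nat.
rewrite natrX expr2 mulrA ler_peMl// -ler_pdivrMl// mulr1.
apply: (@le_trans _ _ m.+1%:R); first by rewrite ltW// truncnS_gt.
by rewrite ler_nat; rewrite /k in kk; lia.
Qed.

(** ** Blocks [[k^2, (k+1)^2)] of one parity have density one half *)

Lemma sqrt_bounds n : (Nat.sqrt n ^ 2 <= n <= Nat.sqrt n ^ 2 + 2 * Nat.sqrt n)%N.
Proof. by have := Nat.sqrt_spec' n; nia. Qed.

Lemma sqrt_mono : {homo Nat.sqrt : i j / (i <= j)%N}.
Proof. by move=> i j /ssrnat.leP /Nat.sqrt_le_mono /ssrnat.leP. Qed.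

(** The exact count is what makes the induction go through: with [k = sqrt n],
    the completed blocks [1, 3, 5, ...] contribute an imbalance of [k] to the
    two parities, and the block in progress has length [n - k^2]. *)
Lemma hits_sqrt (b : bool) (n : nat) :
  (2 * hits [set i | odd (Nat.sqrt i) = b] n)%N =
  (if odd (Nat.sqrt n) == b then 2 * n - (Nat.sqrt n ^ 2 + Nat.sqrt n)
   else Nat.sqrt n ^ 2 + Nat.sqrt n)%N.
Proof.
elim: n => [|n IH]; first by rewrite hits0 /=; case: eqP.
rewrite hitsS mulnDr IH {IH}; set k := Nat.sqrt n.
have := sqrt_bounds n; rewrite -/k => bn; have kk : (k <= k ^ 2)%N by nia.
have := sqrt_bounds n.+1.
have [->|kS] : Nat.sqrt n.+1 = k \/ Nat.sqrt n.+1 = k.+1.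
- have := sqrt_bounds n.+1; set m := Nat.sqrt n.+1 => bm.
  have km : (k <= m)%N by apply: sqrt_mono.
  have : (m <= k.+1)%N by rewrite -(@leq_exp2r _ _ 2)// -(addn1 k) sqrnD; lia.
  by lia.
- have -> : `[< [set i | odd (Nat.sqrt i) = b] n >] = (odd k == b) by apply/asboolP/eqP.
  by case: ifP => _ /=; lia.
have -> : `[< [set i | odd (Nat.sqrt i) = b] n >] = (odd k == b) by apply/asboolP/eqP.
rewrite kS /= -addn1 sqrnD.
by case: b => /=; case: (odd k) => /=; lia.
Qed.

(** By the exact count the parity class of [b] has at most [(n + sqrt n) / 2]
    elements below [n], and [A] at most [N] more. *)
Lemma sqrt_blocks (R : realType) (A : set nat) (N : nat) (b : bool) :
  (forall i, (N <= i)%N -> A i -> odd (Nat.sqrt i) = b) ->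
  (upper_density R A <= (2^-1)%:E)%E.
Proof.
move=> Ab; apply: upper_density_le => e e0; near=> n.
have n0 : (0 < n)%N by near: n; exact: nbhs_infty_gt.
have nR : (0 : R) < n%:R by rewrite ltr0n.
rewrite frequencyE ler_pdivrMr//.
have := @hits_le_cofinite _ [set i | odd (Nat.sqrt i) = b] N n Ab.
have : (2 * hits [set i | odd (Nat.sqrt i) = b] n <= n + Nat.sqrt n)%N.
  by rewrite hits_sqrt; have := sqrt_bounds n; case: eqP; lia.
set h := hits _ _; set k := Nat.sqrt n => h1 h2.
have kn : (k ^ 2 <= n)%N by have := sqrt_bounds n; lia.
have k1 : (0 < k)%N by rewrite lt0n; apply/eqP => k0; have := sqrt_bounds n; rewrite -/k k0; lia.
have : (2 * hits A n)%:R <= (n + k + 2 * N)%:R :> R by rewrite ler_nat; lia.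
rewrite !(natrM, natrD) => h3.
have ek : ((2 * N).+1)%:R / (2 * e) <= k%:R.
  set r := (X in X <= _); have Mn : ((Num.truncn r).+1 ^ 2 <= n)%N.
    by near: n; exact: nbhs_infty_ge.
  apply: (@le_trans _ _ (Num.truncn r).+1%:R); first by rewrite ltW// truncnS_gt.
  rewrite ler_nat -ltnS -(@ltn_exp2r _ _ 2)//; apply: leq_ltn_trans Mn _.
  by have := sqrt_bounds n; rewrite -/k -(addn1 k) sqrnD; lia.
move: ek; rewrite ler_pdivrMr ?mulr_gt0// => ek.
have : k%:R ^+ 2 <= n%:R :> R by rewrite -natrX ler_nat.
have : 1 <= k%:R :> R by rewrite ler1n.
rewrite -(addn1 (2 * N)) natrD natrM in ek.
move: (ler0n R N) => N0 k1R knR.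
have : k%:R * (2 * N%:R + 1) <= k%:R * (k%:R * (2 * e)) by rewrite ler_pM2l// ltr0n.
have : 2 * N%:R <= k%:R * (2 * N%:R) :> R by rewrite ler_peMl// mulr_ge0.
have : k%:R ^+ 2 * (2 * e) <= n%:R * (2 * e) by rewrite ler_pM2r// mulr_gt0.
rewrite expr2; nra.
Unshelve. all: by end_near. Qed.

Lemma iter_continuous (T : topologicalType) (f : T -> T) (j : nat) :
  continuous f -> continuous (iter j f).
Proof.
move=> fc; elim: j => [|j IH] x; first exact: cvg_id.
exact: (continuous_comp (IH x) (fc _)).
Qed.

Lemma open_iter_preimage (T : topologicalType) (f : T -> T) (j : nat) (U : set T) :
  continuous f -> open U -> open (iter j f @^-1` U).
Proof. by move=> fc oU; apply: open_comp => // x _; apply: iter_continuous. Qed.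

(** * Return times to open sets in minimal sets *)

Section Minimal.
Variables (T : topologicalType) (f : T -> T).
Hypotheses (T_compact : compact [set: T]) (f_continuous : continuous f).

Lemma minimal_iter (M : set T) (v : T) (j : nat) :
  minimal_set f M -> M v -> M (iter j f v).
Proof.
by move=> [[_ _ fM] _] Mv; elim: j => //= j IH; apply: fM; exists (iter j f v).
Qed.

(** The points of [M] that never visit [U] form a closed invariant proper subset
    of [M], so there are none; compactness bounds the visiting times. *)
Lemma minimal_return (M U : set T) :
  minimal_set f M -> open U -> M `&` U !=set0 ->
  exists L : nat, forall v, M v -> exists2 j, (j <= L)%N & U (iter j f v).
Proof.
move=> minM oU [x [Mx Ux]].
have visits v : M v -> exists j, U (iter j f v).
  move=> Mv; apply: contrapT => never.
  pose A := M `&` \bigcap_j ~` (iter j f @^-1` U).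
  case: minM => -[M0 cM fM]; move=> /(_ A); apply.
    split.
    - by exists v; split=> // j _ Uj; apply: never; exists j.
    - apply: closedI => //; apply: closed_bigI => j _.
      exact/open_closedC/open_iter_preimage.
    - move=> _ [u [Mu Au] <-]; split; first by apply: fM; exists u.
      by move=> j _ /=; rewrite -iterSr; apply: (Au j.+1).
  split; first by move=> u [].
  by move=> /(_ x Mx) [_ /(_ 0%N I)]; apply.
have cM : compact M.
  by apply: (subclosed_compact _ T_compact) => //; case: minM => -[].
have [] := (compact_near_coveringP M).1 cM nat \oo
    (fun L v => exists2 j, (j <= L)%N & U (iter j f v)) _.
  move=> v /visits [j Uj].
  exists (iter j f @^-1` U, [set L | (j <= L)%N]).
    split; first by apply: open_nbhs_nbhs; split=> //; exact: open_iter_preimage.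
    exact: nbhs_infty_ge.
  by move=> [w L] /= [Uw jL]; exists j.
by move=> L _ LP; exists L; apply: LP => /=.
Qed.

End Minimal.

(** * Consequences of shadowing *)

Section Metric.
Variables (R : realType) (X : metricType R) (f : X -> X).
Hypotheses (X_compact : compact [set: X]) (f_continuous : continuous f).

Lemma open_mdist_ball (x : X) (e : R) : open [set y | mdist x y < e].
Proof.
rewrite openE => y /= xy; apply/nbhs_ballP; exists (e - mdist x y) => /=.
  by rewrite subr_gt0.
move=> z; rewrite ballEmdist /= => yz.
by apply: le_lt_trans (metric_triangle x y z) _; rewrite -ltrBrDl.
Qed.

Lemma open_has_ball (U : set X) (x : X) :
  open U -> U x -> exists2 e : R, 0 < e & forall y, mdist x y < e -> U y.
Proof.
rewrite openE => oU /oU /nbhs_ballP [e /= e0 eU]; exists e => // y xy.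
by apply: eU; rewrite ballEmdist.
Qed.

Lemma uniform_step (eta : R) : 0 < eta ->
  exists2 e : R, 0 < e & forall p q, mdist p q < e -> mdist (f p) (f q) < eta.
Proof.
move=> eta0.
have [] := (compact_near_coveringP _).1 X_compact R (nbhs (0 : R)^'+)
    (fun e p => forall q, mdist p q < e -> mdist (f p) (f q) < eta) _.
  move=> x _.
  have oP : open (f @^-1` [set y | mdist (f x) y < eta / 2]).
    by apply: open_comp => //; exact: open_mdist_ball.
  have [d d0 dP] : exists2 d : R, 0 < d &
      forall q, mdist x q < d -> mdist (f x) (f q) < eta / 2.
    by apply: (open_has_ball oP); rewrite /= mdistxx divr_gt0.
  exists ([set y | mdist x y < d / 2], [set e | e <= d / 2]).
    split; last by apply: nbhs_right_le; rewrite divr_gt0.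
    apply: open_nbhs_nbhs; split; first exact: open_mdist_ball.
    by rewrite /= mdistxx divr_gt0.
  move=> [p e] /= [xp ed] q pq.
  have := dP p; have := dP q => /=.
  have := metric_triangle x p q; have := metric_triangle (f p) (f x) (f q).
  rewrite (metric_sym (f p) (f x)) => t1 t2 /(_ ltac:(lra)) h1 /(_ ltac:(lra)) h2.
  lra.
move=> e /= e0 eP; exists (e / 2); first by rewrite divr_gt0.
move=> p q; apply: (eP (e / 2)) => //=; rewrite ?divr_gt0//.
by rewrite sub0r normrN gtr0_norm ?divr_gt0// ltr_pdivrMr// ltr_pMr// ltr1n.
Qed.

Lemma uniform_iter (L : nat) (eta : R) : 0 < eta ->
  exists2 e : R, 0 < e & forall p q, mdist p q < e ->
    forall j, (j <= L)%N -> mdist (iter j f p) (iter j f q) < eta.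
Proof.
move=> eta0; elim: L => [|L [e e0 eP]].
  by exists eta => // p q pq [].
have [e' e'0 e'P] := uniform_step e0.
exists (Num.min eta e'); first by rewrite lt_min eta0.
move=> p q; rewrite lt_min => /andP[pq pq'] [|j] // jL.
by rewrite !iterSr; apply: eP => //; apply: e'P.
Qed.

(** If the tracing times met the blocks of one of the two orbits only finitely
    often, they would eventually lie in blocks of a single parity, whose density
    is too small for the shadowing hypothesis. *)
Lemma trace_two_orbits (x y : X) (eps : R) :
  lower_density_shadowing f \/ upper_density_shadowing f -> 0 < eps ->
  exists z, (forall N, exists2 i, (N <= i)%N & mdist (iter i f z) (iter i f x) < eps)
    /\ (forall N, exists2 i, (N <= i)%N & mdist (iter i f z) (iter i f y) < eps).
Proof.
move=> shadow eps0.
have [kappa [mono [slow [z zP]]]] : exists kappa : nat -> nat,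
    {homo kappa : i j / (i <= j)%N} /\ (forall n, (kappa n ^ 2 <= n)%N) /\
    exists z, forall N b, ~ (forall i, (N <= i)%N ->
      tracing_times f eps (switch_orbit kappa f x y) z i -> odd (kappa i) = b).
  case: shadow => /(_ eps eps0) [delta delta0 shadow].
    exists (fun i => trunc_log 2 (trunc_log 2 i)).
    have mono : {homo (fun i => trunc_log 2 (trunc_log 2 i)) : i j / (i <= j)%N}.
      by move=> i j ij; rewrite !leq_trunc_log.
    split=> //; split; first exact: double_log_slow.
    have [z zP] := shadow _ (switch_orbit_ergodic f x y mono double_log_slow delta0).
    exists z => N b /(double_log_blocks R); apply/negP; by rewrite -ltNge.
  have slow n : (Nat.sqrt n ^ 2 <= n)%N by have /andP[] := sqrt_bounds n.
  exists Nat.sqrt; split; [exact: sqrt_mono|split=> //].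
  have [z zP] := shadow _ (switch_orbit_ergodic f x y sqrt_mono slow delta0).
  by exists z => N b /(sqrt_blocks R); apply/negP; rewrite -ltNge.
exists z; split=> N; apply: contrapT => none.
  apply: (zP N false) => i Ni; rewrite /tracing_times /switch_orbit /=.
  by case: odd => // h; case: none; exists i.
apply: (zP N true) => i Ni; rewrite /tracing_times /switch_orbit /=.
by case: odd => // h; case: none; exists i.
Qed.

(** The pair of visits of [x] and [w] to [U], followed after the same lapse [m]
    by visits of [y] and [w] to [V], is what links the return times of two
    different points: here [w] follows [x] at first and [y] later. *)
Lemma parallel_visits (M N U V : set X) (x y : X) :
  lower_density_shadowing f \/ upper_density_shadowing f ->
  minimal_set f M -> M x -> open U -> M `&` U !=set0 ->
  minimal_set f N -> N y -> open V -> N `&` V !=set0 ->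
  exists a m w, [/\ U (iter a f x), U w, V (iter m f w) & V (iter (a + m) f y)].
Proof.
(* Points that are close to some v in M' enter W together with v, within a
   time bounded independently of v. *)
have inner M' W : minimal_set f M' -> open W -> M' `&` W !=set0 ->
  exists L (e : R), 0 < e /\ forall v z, M' v -> mdist z v < e ->
    exists2 j, (j <= L)%N & W (iter j f v) /\ W (iter j f z).
  move=> minM oW [p [Mp Wp]].
  have [e e0 eW] := open_has_ball oW Wp.
  have [L LP] := minimal_return X_compact f_continuous minM
    (@open_mdist_ball p (e / 2)) ltac:(by exists p; split; rewrite //= mdistxx divr_gt0).
  have [d d0 dP] := @uniform_iter L (e / 2) ltac:(by rewrite divr_gt0).
  exists L, d; split=> // v z Mv zv; have [j jL /= vj] := LP v Mv.
  exists j => //; split; apply: eW; first by lra.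
  have := dP _ _ zv j jL; rewrite metric_sym => vz.
  by have := metric_triangle p (iter j f v) (iter j f z); lra.
move=> shadow minM Mx oU MU minN Ny oV NV.
have [L [e [e0 eP]]] := inner _ _ minM oU MU.
have [L' [e' [e'0 e'P]]] := inner _ _ minN oV NV.
have [z [zx zy]] := @trace_two_orbits x y (Num.min e e') shadow ltac:(by rewrite lt_min e0).
have [i _] := zx 0%N; rewrite lt_min => /andP[zxi _].
have [j jL [Ux Uz]] := eP _ _ (minimal_iter i minM Mx) zxi.
(* The second visit is sought after the first one, so that the lapse between
   them is a natural number. *)
have [i' ii'] := zy (j + i)%N; rewrite lt_min => /andP[_ zyi].
have [j' _ [Vy Vz]] := e'P _ _ (minimal_iter i' minN Ny) zyi.
exists (j + i)%N, (j' + i' - (j + i))%N, (iter (j + i) f z).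
rewrite -!iterD in Ux Uz Vy Vz *; split=> //.
  by rewrite subnK// (leq_trans ii')// leq_addl.
by rewrite addnC subnK// (leq_trans ii')// leq_addl.
Qed.

Hypothesis minimal_dense : dense [set x : X | minimal_point f x].
Hypothesis shadowing : lower_density_shadowing f \/ upper_density_shadowing f.

Lemma transitive (U V : set X) : open U -> U !=set0 -> open V -> V !=set0 ->
  exists m w, U w /\ V (iter m f w).
Proof.
move=> oU U0 oV V0.
have [x [Ux [M minM Mx]]] := minimal_dense U0 oU.
have [y [Vy [N minN Ny]]] := minimal_dense V0 oV.
have [_ [m [w [_ Uw Vw _]]]] := parallel_visits shadowing minM Mx oU
  ltac:(by exists x) minN Ny oV ltac:(by exists y).
by exists m, w.
Qed.

(** Take [y = f x] and [V = U] in [parallel_visits]: the tracing point returns to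
    [U] after [m] steps, while the orbit of [x], one step ahead, returns after
    [m + 1]. *)
Lemma consecutive_returns (U : set X) : open U -> U !=set0 ->
  exists m w w', [/\ U w, U (iter m f w), U w' & U (iter m.+1 f w')].
Proof.
move=> oU U0; have [x [Ux [M minM Mx]]] := minimal_dense U0 oU.
have [a [m [w [Ua Uw Um Uam]]]] := parallel_visits shadowing minM Mx oU
  ltac:(by exists x) minM (minimal_iter 1 minM Mx) oU ltac:(by exists x).
exists m, w, (iter a f x); split=> //.
by rewrite -iterD addSn addnC iterSr.
Qed.

(** During a long interval of times at which the images of [U] have diameter at
    most [delta], consecutive return times make a minimal orbit starting in [U]
    move by at most [3 * delta] per step; this orbit can be chosen to pass within
    [delta] of [v], with its image within [delta] of [f v]. *)
Lemma insensitive_displacement (U : set X) (delta : R) (v : X) :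
  0 < delta -> open U -> U !=set0 -> ~ syndetic (sensitivity_times f delta U) ->
  mdist v (f v) <= 5 * delta.
Proof.
move=> delta0 oU U0 insens.
have close (k : nat) : exists i, forall m, (i <= m <= i + k)%N ->
    forall p q, U p -> U q -> mdist (iter m f p) (iter m f q) <= delta.
  apply: contrapT => /forallNP sens; apply: insens; exists k.+1 => // i.
  apply: contrapT => none; apply: (sens i) => m im p q Up Uq.
  rewrite leNgt; apply/negP => far; apply: none; exists m; split.
    by exists p, q.
  by rewrite /=; lia.
pose V := [set u | mdist v u < delta] `&` f @^-1` [set u | mdist (f v) u < delta].
have oV : open V.
  apply: openI; first exact: open_mdist_ball.
  by apply: open_comp => //; exact: open_mdist_ball.
have V0 : V !=set0 by exists v; split; rewrite /= mdistxx.
have [t [w0 [Uw0 Vw0]]] := transitive oU U0 oV V0.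
have [w [[Uw Vw] [M minM Mw]]] := minimal_dense
  (ex_intro _ w0 (conj Uw0 Vw0) : (U `&` iter t f @^-1` V) !=set0)
  (openI oU (open_iter_preimage t f_continuous oV)).
have [s [p [p' [Up Ups Up' Ups']]]] := consecutive_returns oU U0.
have [L LP] := minimal_return X_compact f_continuous minM oV
  (ex_intro _ _ (conj (minimal_iter t minM Mw) Vw)).
have [i iP] := close (L + s.+1)%N.
have [j jL [/= Vj Vfj]] := LP _ (minimal_iter (s + i) minM Mw).
rewrite -iterD -?iterS in Vj Vfj.
(* Time s + (i + j) is reached from w through p; p and p' enter U after s and
   s + 1 steps, so they agree i + j steps later; p' leads back to w. *)
have h1 := iP (j + (s + i))%N ltac:(lia) _ _ Uw Up.
have h2 := iP (j + i)%N ltac:(lia) _ _ Ups Ups'.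
have h3 := iP (j + (s + i)).+1 ltac:(lia) _ _ Up' Uw.
rewrite -!iterD in h2.
rewrite (_ : j + i + s = j + (s + i))%N in h2; last lia.
rewrite (_ : j + i + s.+1 = (j + (s + i)).+1)%N in h2; last lia.
move: Vj Vfj h1 h2 h3; set u := iter (j + (s + i)) f w; set u' := iter _.+1 f w.
set q := iter _ f p; set q' := iter _.+1 f p' => Vj Vfj h1 h2 h3.
rewrite metric_sym in Vfj.
have := metric_triangle v u (f v); have := metric_triangle u q (f v).
have := metric_triangle q q' (f v); have := metric_triangle q' u' (f v).
lra.
Qed.

Lemma syndetically_sensitive_of_shadowing :
  (exists x y : X, x <> y) -> syndetically_sensitive f.
Proof.
move=> [x [y xy]]; apply: contrapT => insens.
have f_id v : f v = v.
  apply/esym/mdist_positivity/eqP; rewrite eq_le mdist_ge0 andbT.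
  rewrite leNgt; apply/negP => d0.
  apply: insens; exists (mdist v (f v) / 6); first by rewrite divr_gt0.
  move=> U oU U0; apply: contrapT => bad.
  have := @insensitive_displacement U (mdist v (f v) / 6) v ltac:(by rewrite divr_gt0) oU U0 bad.
  lra.
have := @metric_hausdorff R X; rewrite open_hausdorff => /(_ x y ltac:(by apply/eqP)).
move=> [[U V] /= [/set_mem Ux /set_mem Vy] [oU oV /eqP UV]].
have [m [w [Uw]]] := transitive oU (ex_intro _ _ Ux) oV (ex_intro _ _ Vy).
rewrite (_ : iter m f w = w) => [Vw|]; last by elim: m => //= m ->.
by have : (U `&` V) w by []; rewrite UV.
Qed.

(** A time [m] at which [f] separates two points is at most [n] steps after a
    multiple of [n], at which they were already separated by uniform
    continuity. *)
Lemma syndetically_sensitive_iter (n : nat) : (0 < n)%N ->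
  syndetically_sensitive f -> syndetically_sensitive (iter n f).
Proof.
move=> n0 [delta delta0 sens].
have [e e0 eP] := uniform_iter n delta0.
exists (e / 2) => [|U oU U0]; first by rewrite divr_gt0.
have [k k0 kP] := sens U oU U0; exists k => // i.
have [m [[p [q [Up Uq far]]] /= mk]] := kP (i * n)%N.
exists (m %/ n)%N; split; last first.
  rewrite /= leq_divRL//; case/andP: mk => -> /= mk.
  rewrite -ltnS ltn_divLR//; apply: leq_ltn_trans mk _; nia.
exists p, q; split=> //; rewrite ltNge; apply/negP => near.
have := eP (iter (m %/ n) (iter n f) p) (iter (m %/ n) (iter n f) q) ltac:(lra)
  (m %% n)%N (ltnW (ltn_pmod m n0)).
have iterM r : iter (m %/ n) (iter n f) r = iter (m %/ n * n) f r.
  by elim: (m %/ n)%N => //= j ->; rewrite mulSn iterD.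
by rewrite !iterM -!iterD addnC -divn_eq; lra.
Qed.

End Metric.

Theorem corollary7p13 (R : realType) (X : metricType R) (f : X -> X)
    (X_compact : compact [set: X]) (f_continuous : continuous f)
    (X_two_points : exists x y : X, x <> y)
    (minimal_dense : dense [set x : X | minimal_point f x])
    (shadowing : lower_density_shadowing f \/ upper_density_shadowing f)
    (n : nat) (n_gt0 : (0 < n)%N) :
  syndetically_sensitive (iter n f).
Proof.
exact/syndetically_sensitive_iter/syndetically_sensitive_of_shadowing.
Qed.
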